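(* Let $M=\{\bigcap_{x\in E}\mathord{\downarrow}x\mid \emptyset\neq E\subseteq P\}$, ordered by inclusion, where $P$ is the poset described in the context, and let $R=M\cup\{T\}$ be obtained from $M$ by adding a new greatest element $T$. Let $\mathcal{F}=\{\mathord{\downarrow}F\mid F\text{ a finite subset of }R\}$, where $\mathord{\downarrow}F=\{r\in R\mid r\le u\text{ for some }u\in F\}$. Then $(\mathcal{F},\subseteq)$ is a countable distributive complete lattice whose Scott space $\Sigma\mathcal{F}$ is not sober.
   Context: $\mathbb{N}$ is the set of positive integers and $\mathbb{N}^{<\mathbb{N}}$ is the set of non-empty finite sequences of elements of $\mathbb{N}$; $s.t$ denotes concatenation, and $|s|$ the length of $s$. For $s,t\in\mathbb{N}^{<\mathbb{N}}$, $s\le t$ means that $s$ is a prefix of $t$ (possibly $s=t$). A natural number $x$ is also regarded as the sequence of length one when it is an argument of a function on $\mathbb{N}^{<\mathbb{N}}$ or appears in a concatenation. Let $L$ be the disjoint union $\mathbb{N}\cup\mathbb{N}^{<\mathbb{N}}\cup\{\top\}$ ordered by: $x\le y$ iff $x,y\in\mathbb{N}$ and $x\le y$ in the usual order; or $x,y\in\mathbb{N}^{<\mathbb{N}}$ and $x$ is a prefix of $y$; or $y=\top$. For every pair $(m,n)\in\mathbb{N}\times\mathbb{N}$ with $m<n$ fix an infinite set $i(m,n)\subseteq\mathbb{N}$ such that every element of $i(m,n)$ is strictly greater than $n$, and such that $i(m_1,n_1)\cap i(m_2,n_2)=\emptyset$ for distinct pairs $(m_1,n_1)\ne(m_2,n_2)$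 with $m_1<n_1$, $m_2<n_2$. For each $(m,n)$ with $m<n$ fix a monotone bijection $f_{m,n}:\mathbb{N}^{<\mathbb{N}}\to i(m,n)$ (monotone from the prefix order to the usual order). Let $P=\mathbb{N}\times L$ as a set, with the relations: - $(n,x)<_1(m,y)$ iff $n=m$ and $x<y$ in $L$; - $(n,x)<_2(m,y)$ iff $y=\top$, $x\in\mathbb{N}^{<\mathbb{N}}$, and there is $k\in\mathbb{N}$ with $k>n$, $m\in i(n,k)$ and $m=f_{n,k}(x)$; - $(n,x)<_3(m,y)$ iff $y=\top$, $x\in\mathbb{N}$, and there is $d\in\mathbb{N}$ with $d<n$, $m\in i(d,n)$ and $m=f_{d,n}(x)$; - $(n,x)<_4(m,y)$ iff $y=\top$, $x\in\mathbb{N}$, and there are $a,b\in\mathbb{N}$ with $a<b$ and $s\in\mathbb{N}^{<\mathbb{N}}$ such that $f_{a,b}(s)=n$ and $f_{a,b}(s.x)=m$. Let $<$ be the union of $<_1,<_2,<_3,<_4$ and the relation compositions $<_1;<_2$, $<_1;<_3$, $<_1;<_4$ (where $u\,(<_1;<_j)\,v$ iff there is $w$ with $u<_1w<_jv$). The order on $P$ is $u\le v$ iff $u<v$ or $u=v$. For $x\in P$, $\mathord{\downarrow}x=\{y\in P\mid y\le x\}$. For a poset $Q$, $\Sigma Q$ is $Q$ with the Scott topology: $U\subseteq Q$ is open iff it is an upper set and every directed $D\subseteq Q$ whose supremum exists and lies in $U$ meets $U$. A space is sober if it is $T_0$ and every irreducible closed subset is the closure of a (unique) point. *)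

(* Defs.v *)
From HB Require Import structures.
From mathcomp Require Import all_boot all_order.
From mathcomp Require Import all_classical.
From mathcomp Require Import topology.

Set Implicit Arguments.
Unset Strict Implicit.
Unset Printing Implicit Defensive.

Import Order.TTheory.
Local Open Scope order_scope.
Local Open Scope classical_set_scope.

Definition posnat := {n : nat | (0 < n)%N}.

HB.instance Definition _ :=
  [Order of posnat by <:].

Definition neseq := {s : seq posnat | s != [::]}.

HB.instance Definition _ := Countable.on neseq.

Definition neseq_le (s t : neseq) : bool := prefix (val s) (val t).

Lemma neseq_le_refl : reflexive neseq_le.
Proof. by move=> s; exact: prefix_refl. Qed.

Lemma neseq_le_anti : antisymmetric neseq_le.
Proof.
move=> s t /andP[/prefixP[s' ts] /prefixP[t' st]]; apply/val_inj.
suff /eqP t'0 : t' == [::] by rewrite st t'0 cats0.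
have /eqP := congr1 size st; rewrite {1}ts !size_cat -addnA.
by rewrite -[X in X == _]addn0 eqn_add2l eq_sym addn_eq0 !size_eq0 => /andP[].
Qed.

Lemma neseq_le_trans : transitive neseq_le.
Proof. by move=> t s u; exact: prefix_trans. Qed.

Fact neseq_display : Order.disp_t. Proof. by []. Qed.

HB.instance Definition _ := Order.Le_isPOrder.Build neseq_display neseq
  neseq_le_refl neseq_le_anti neseq_le_trans.

Lemma neseq_rcons_subproof (s : neseq) (x : posnat) : rcons (val s) x != [::].
Proof. by case: (val s). Qed.

Definition neseq_rcons (s : neseq) (x : posnat) : neseq :=
  Sub (rcons (val s) x) (neseq_rcons_subproof s x).

Inductive L : Type :=
| LNat of posnat
| LSeq of neseq
| LTop.

HB.instance Definition _ := gen_eqMixin L.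
HB.instance Definition _ := gen_choiceMixin L.

Definition L_le (x y : L) : bool :=
  match x, y with
  | LNat m, LNat n => m <= n
  | LSeq s, LSeq t => s <= t
  | _, LTop => true
  | _, _ => false
  end.

Lemma L_le_refl : reflexive L_le.
Proof. by case=> [m|s|] /=. Qed.

Lemma L_le_anti : antisymmetric L_le.
Proof. by case=> [m|s|] [n|t|] //= /le_anti ->. Qed.

Lemma L_le_trans : transitive L_le.
Proof. by case=> [m|s|] [n|t|] [p|u|] //=; exact: le_trans. Qed.

Fact L_display : Order.disp_t. Proof. by []. Qed.

HB.instance Definition _ := Order.Le_isPOrder.Build L_display L
  L_le_refl L_le_anti L_le_trans.

Section PosetP.
(* Only the values [i m n] and [f m n] with [m < n] are ever used. *)
Variables (i : posnat -> posnat -> set posnat).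
Variables (f : posnat -> posnat -> neseq -> posnat).

Local Notation PT := (posnat * L)%type.

Definition P_lt1 (u v : PT) : Prop := u.1 = v.1 /\ u.2 < v.2.

Definition P_lt2 (u v : PT) : Prop :=
  v.2 = LTop /\ exists2 s : neseq, u.2 = LSeq s &
    exists k, [/\ u.1 < k, i u.1 k v.1 & v.1 = f u.1 k s].

Definition P_lt3 (u v : PT) : Prop :=
  v.2 = LTop /\ exists2 x : posnat, u.2 = LNat x &
    exists d, [/\ d < u.1, i d u.1 v.1 &
                  v.1 = f d u.1 (Sub [:: x] isT)].

Definition P_lt4 (u v : PT) : Prop :=
  v.2 = LTop /\ exists2 x : posnat, u.2 = LNat x &
    exists a b s, [/\ a < b, f a b s = u.1 & f a b (neseq_rcons s x) = v.1].

Definition P_lt234 (u v : PT) : Prop := [\/ P_lt2 u v, P_lt3 u v | P_lt4 u v].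

Definition P_lt (u v : PT) : bool :=
  `[< [\/ P_lt1 u v, P_lt234 u v | exists2 w, P_lt1 u w & P_lt234 w v] >].

Lemma P_lt1_trans u v w : P_lt1 u v -> P_lt1 v w -> P_lt1 u w.
Proof.
move=> [uv1 uv] [vw1 vw]; split; first by rewrite uv1.
exact: lt_trans uv vw.
Qed.

Lemma P_lt234_top u v : P_lt234 u v -> v.2 = LTop.
Proof. by case=> -[]. Qed.

Lemma P_lt_ntop u v : P_lt u v -> u.2 <> LTop.
Proof.
have lt1N a b : P_lt1 a b -> a.2 <> LTop.
  move=> [_] /[swap] ->; case: (b.2) => [m|s|]; last by rewrite ltxx.
  - by move/ltW.
  - by move/ltW.
case/asboolP => [/lt1N//||[w /lt1N//]].
by case=> -[_ [x -> _]].
Qed.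

Lemma P_lt_irr : irreflexive P_lt.
Proof.
move=> u; apply/negP => uu; have uNT := P_lt_ntop uu.
case/asboolP: uu => [[_]||[w _]]; first by rewrite ltxx.
- by move/P_lt234_top.
- by move/P_lt234_top.
Qed.

Lemma P_lt_trans : transitive P_lt.
Proof.
move=> v u w uv vw; have vNT := P_lt_ntop vw.
case/asboolP: uv => [uv|/P_lt234_top//|[? _ /P_lt234_top//]].
apply/asboolP; case/asboolP: vw => [vw|vw|[v' vv' v'w]].
- by constructor 1; exact: P_lt1_trans vw.
- by constructor 3; exists v.
- by constructor 3; exists v' => //; exact: P_lt1_trans vv'.
Qed.

End PosetP.

(* The carrier does not depend on [i] and [f], but the order does. *)
Definition P (i : posnat -> posnat -> set posnat)
  (f : posnat -> posnat -> neseq -> posnat) : Type := (posnat * L)%type.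

Fact P_display : Order.disp_t. Proof. by []. Qed.

HB.instance Definition _ i f := Choice.copy (P i f) (posnat * L)%type.
HB.instance Definition _ i f := Order.Lt_isPOrder.Build P_display
  (P i f) (@P_lt_irr i f) (@P_lt_trans i f).

Definition M i f : Type := set_type
  [set \bigcap_(x in E) [set y | y <= x]
     | E in [set E : set (P i f) | E !=set0]].

HB.instance Definition _ i f := SubChoice.on (M i f).
HB.instance Definition _ i f :=
  [SubChoice_isSubPOrder of M i f by <: with set_display].

Definition add_top (T : Type) : Type := option T.

Section AddTop.
Context {d : Order.disp_t} {T : porderType d}.

HB.instance Definition _ := Choice.copy (add_top T) (option T).

(* [None] is the new top *)
Definition add_top_le (x y : add_top T) : bool :=
  match x, y with
  | _, None => true
  | Some a, Some b => a <= b
  | None, Some _ => false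
  end.

Lemma add_top_le_refl : reflexive add_top_le.
Proof. by case=> [a|] /=. Qed.

Lemma add_top_le_anti : antisymmetric add_top_le.
Proof. by case=> [a|] [b|] //= /le_anti ->. Qed.

Lemma add_top_le_trans : transitive add_top_le.
Proof. by case=> [a|] [b|] [c|] //=; exact: le_trans. Qed.

HB.instance Definition _ := Order.Le_isPOrder.Build d (add_top T)
  add_top_le_refl add_top_le_anti add_top_le_trans.

End AddTop.

Definition R i f : Type := add_top (M i f).

HB.instance Definition _ i f := Order.POrder.on (R i f).

Definition F i f : Type :=
  set_type [set down A | A in [set A : set (R i f) | finite_set A]].

HB.instance Definition _ i f := SubChoice.on (F i f).
HB.instance Definition _ i f :=
  [SubChoice_isSubPOrder of F i f by <: with set_display].

Section Lattices.
Context {d : Order.disp_t} (T : porderType d).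

Definition complete_lattice : Prop :=
  forall A : set T, supremums A !=set0 /\ infimums A !=set0.

Definition distributive_lattice : Prop :=
  exists meet join : T -> T -> T,
    [/\ forall x y, infimums [set x; y] (meet x y),
        forall x y, supremums [set x; y] (join x y) &
        left_distributive meet join].

End Lattices.

Definition scott (T : Type) : Type := T.

Section Scott.
Context {d : Order.disp_t} {T : porderType d}.

Definition directed_set (D : set T) : Prop :=
  D !=set0 /\
  forall x y, D x -> D y -> exists2 z, D z & x <= z /\ y <= z.

Definition scott_open (U : set T) : Prop :=
  (forall x y, x <= y -> U x -> U y) /\
  (forall D s, directed_set D -> supremums D s -> U s -> D `&` U !=set0).

Lemma scott_openT : scott_open setT.
Proof. by split=> // D s [[x Dx] _] _ _; exists x. Qed.

Lemma scott_openI : setI_closed scott_open.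
Proof.
move=> U V [Uup UD] [Vup VD]; split.
  by move=> x y xy [Ux Vx]; split; [exact: Uup Ux|exact: Vup Vx].
move=> D s dD Ds [Us Vs].
have [x [Dx Ux]] := UD D s dD Ds Us; have [y [Dy Vy]] := VD D s dD Ds Vs.
have [z Dz [xz yz]] := dD.2 x y Dx Dy.
by exists z; split=> //; split; [exact: Uup Ux|exact: Vup Vy].
Qed.

Lemma scott_open_bigU (I : Type) (U : I -> set T) :
  (forall j, scott_open (U j)) -> scott_open (\bigcup_j U j).
Proof.
move=> oU; split; first by move=> x y xy [j _ Ujx]; exists j => //; exact: (oU j).1 Ujx.
move=> D s dD Ds [j _ Ujs]; have [x [Dx Ujx]] := (oU j).2 D s dD Ds Ujs.
by exists x; split=> //; exists j.
Qed.

HB.instance Definition _ := Choice.copy (scott T) T.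
HB.instance Definition _ := isOpenTopological.Build (scott T)
  scott_openT scott_openI scott_open_bigU.

End Scott.

Section Sober.
Context (X : topologicalType).

Definition irreducible_set (A : set X) : Prop :=
  A !=set0 /\
  forall B C : set X, closed B -> closed C -> A `<=` B `|` C ->
    A `<=` B \/ A `<=` C.

Definition sober_space : Prop :=
  kolmogorov_space X /\
  forall A : set X, closed A -> irreducible_set A ->
    exists x, A = closure [set x].

End Sober.

(* Main.v *)
(* Write [top m] for [(m, LTop)].  Apart from the points of level [m], only
   finitely many points lie below [top m], and they form one chain of sequences
   and one chain of numbers.  Hence every element of [M] is either the lower set
   of some [top m] or finite, so [M] is countable and well-founded.  In a
   well-founded poset with binary meets, arbitrary intersections of finitely
   generated lower sets are finitely generated; this makes [F] a complete
   lattice of sets closed under union and intersection.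

   The elements of [F] lying below the image of some [top m] form a closed
   irreducible set without a largest element.  Closed: a set of points of [P]
   each finite part of which is bounded by some [top m] is bounded by a single
   [top m].  Irreducible: [top n] is the supremum of the numbers of level [n],
   and of the points along any infinite branch of sequences of level [n].  Given
   opens [U] and [V] containing [top n] and [top m] with [n < m], the first fact
   applied to [V] builds an infinite branch [s 0 <= s 1 <= ...] such that [V]
   contains every [top (f n m (s k))], and the second fact yields [k] with
   [(n, s k) \in U], so that [U] contains [top (f n m (s k))] too. *)
Require Import Defs.
From mathcomp Require Import all_boot all_order.
From mathcomp Require Import all_classical.
From mathcomp Require Import finmap topology.

Local Open Scope order_scope.
Local Open Scope classical_set_scope.

Set Implicit Arguments.
Unset Strict Implicit.
Import Order.TTheory.

(** * Sequences of length one and one-letter extensions in the prefix order *)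

Definition neseq1 (x : posnat) : neseq := Sub [:: x] isT.

Lemma neseq1_rcons_neq x p z : neseq1 x <> neseq_rcons p z.
Proof.
by move/(congr1 (size \o val)) => /=; rewrite size_rcons; case: p => [[]].
Qed.

Lemma neseq_rcons_inj p z p' z' :
  neseq_rcons p z = neseq_rcons p' z' -> p = p' /\ z = z'.
Proof. by move=> /(congr1 val)/= /rcons_inj[/(@val_inj _ _ neseq) -> ->]. Qed.

Lemma le_neseq_rcons p z : p <= neseq_rcons p z.
Proof. exact: prefix_rcons. Qed.

Lemma neseq_le_size (s t : neseq) : s <= t -> (size (val s) <= size (val t))%N.
Proof. exact: size_prefix. Qed.

Lemma neseq_le1 (s : neseq) z : s <= neseq1 z -> s = neseq1 z.
Proof.
case: s => [[|x [|y s]] s0] // /prefixP[t [-> _]] //; exact: val_inj.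
Qed.

Lemma neseq_le_rcons (s : neseq) p z :
  s <= neseq_rcons p z -> s = neseq_rcons p z \/ s <= p.
Proof.
move=> /prefixP[t]; case/lastP: t => [|t z'].
  by rewrite cats0 => st; left; apply: val_inj; rewrite st.
by rewrite -rcons_cat => /rcons_inj[ps _]; right; apply/prefixP; exists t.
Qed.

(** * The order of [P] and the points lying below a top *)

Section Order_on_P.
Variables (i : posnat -> posnat -> set posnat).
Variables (f : posnat -> posnat -> neseq -> posnat).
Hypothesis i_disjoint : forall m1 n1 m2 n2 : posnat, m1 < n1 -> m2 < n2 ->
     (m1, n1) <> (m2, n2) -> i m1 n1 `&` i m2 n2 = set0.
Hypothesis f_bij :
  forall m n : posnat, m < n -> set_bij [set: neseq] (i m n) (f m n).

Local Notation P := (P i f).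
Local Notation top := (fun m : posnat => (m, LTop) : P).

Lemma f_in a b s : a < b -> i a b (f a b s).
Proof. by move=> /f_bij[fab _ _]; exact: fab. Qed.

(** Disjointness of the sets [i a b] glues the maps [f a b] into one injection, so a level has at
    most one code [(a, b, s)]. The uniqueness arguments about points below a top rest on this. *)
Lemma f_inj a b s a' b' s' : a < b -> a' < b' ->
  f a b s = f a' b' s' -> [/\ a = a', b = b' & s = s'].
Proof.
move=> ab ab' e; have [[aa bb]|ne] := pselect ((a, b) = (a', b')).
  subst a' b'; split=> //; have [_ /(_ s s') inj _] := f_bij ab.
  by apply: inj => //; rewrite in_setE.
have := i_disjoint ab ab' ne; have := f_in s ab.
rewrite -subset0 => x /(_ (f a b s)).
by case; split=> //; rewrite e; exact: f_in.
Qed.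

Lemma P_ltE (u v : P) : (u < v) = P_lt i f u v.
Proof. by []. Qed.

Lemma level_le n (x y : L) : x <= y -> ((n, x) : P) <= (n, y).
Proof.
rewrite le_eqVlt => /predU1P[->//|xy]; apply: ltW; rewrite P_ltE.
by apply/asboolP; constructor 1; split.
Qed.

Lemma le_nontop n m (x y : L) : y <> LTop -> ((n, x) : P) <= (m, y) ->
  n = m /\ x <= y.
Proof.
move=> yT; rewrite le_eqVlt => /predU1P[[-> ->]//|]; rewrite P_ltE.
case/asboolP => [[/= -> /ltW//]|/P_lt234_top//|[w _ /P_lt234_top//]].
Qed.

(** Normal form of a point below [top m] from another level: one constructor for each of [P_lt2],
    [P_lt3] and [P_lt4]. A preceding [P_lt1] step is absorbed into the inequality, and membership in
    [i] is left to [f_in]. *)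
Variant under_top (m n : posnat) : L -> Prop :=
| UnderTopSeq k s t of n < k & s <= t & m = f n k t : under_top m n (LSeq s)
| UnderTopNat1 a y z of a < n & y <= z & m = f a n (neseq1 z) :
    under_top m n (LNat y)
| UnderTopNat a b p y z of a < b & n = f a b p & y <= z &
    m = f a b (neseq_rcons p z) : under_top m n (LNat y).

Lemma under_top_le n m x : under_top m n x -> (n, x) <= top m :> P.
Proof.
case=> [k s t nk st ->|a z z' an zz ->|a b p z z' ab -> zz ->].
- apply: (@le_trans _ _ ((n, LSeq t) : P)); first exact: level_le.
  apply: ltW; rewrite P_ltE; apply/asboolP; constructor 2; constructor 1.
  split=> //; exists t => //; exists k; split=> //; exact: f_in.
- apply: (@le_trans _ _ ((n, LNat z') : P)); first exact: level_le.
  apply: ltW; rewrite P_ltE; apply/asboolP; constructor 2; constructor 2.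
  split=> //; exists z' => //; exists a; split=> //; exact: f_in.
- apply: (@le_trans _ _ ((f a b p, LNat z') : P)); first exact: level_le.
  apply: ltW; rewrite P_ltE; apply/asboolP; constructor 2; constructor 3.
  by split=> //; exists z' => //; exists a, b, p.
Qed.

Lemma under_topP n m x : n <> m -> (n, x) <= top m :> P <-> under_top m n x.
Proof.
move=> nm; have lt234 y : P_lt234 i f (n, y) (m, LTop) -> under_top m n y.
  case=> -[_ [s /= ->]].
  - by move=> [k [nk _ ->]]; exact: UnderTopSeq nk _ _.
  - by move=> [d [dn _ ->]]; exact: UnderTopNat1 dn _ _.
  - by move=> [a [b [t [ab <- <-]]]]; exact: UnderTopNat ab _ _ _.
split; last exact: under_top_le.
rewrite le_eqVlt => /predU1P[[/nm//]|]; rewrite P_ltE.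
case/asboolP => [[/nm//]|/lt234//|[[n' y] [/= <- /ltW xy] /lt234 ny]].
case: ny xy => [k s t nk st ->|a z z' an zz ->|a b p z z' ab -> zz ->].
- case: x => // s' s's; apply: UnderTopSeq nk _ _; last by reflexivity.
  exact: le_trans st.
- case: x => // y' y'y; apply: UnderTopNat1 an _ _; last by reflexivity.
  exact: le_trans zz.
- case: x => // y' y'y; apply: UnderTopNat ab _ _ _; [by []| |by reflexivity].
  exact: le_trans zz.
Qed.

Lemma le_top (u : P) : u <= top u.1.
Proof. by case: u => n x; apply: level_le; case: x. Qed.

Lemma top_le n (v : P) : top n <= v -> v = top n.
Proof.
rewrite le_eqVlt => /predU1P[//|]; rewrite P_ltE => /P_lt_ntop; exact.
Qed.

(** The sequence gives [m = f n k t] with [s <= t]. By [f_inj] the number uses the same code, so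
    either [c = k] and [t] has length one, or [c = f n k p] with [p] the parent of [t]. In the
    latter case [s <= p] would put [(n, s)] below [top c], whence [s = t]. *)
Lemma under_top_pair n c m s y :
    n <> m -> c <> m -> ((n, LSeq s) : P) <= top m ->
    ((c, LNat y) : P) <= top m -> ~ ((n, LSeq s) : P) <= top c ->
  (n < c /\ exists2 z, s = neseq1 z & m = f n c s) \/
  exists b p z, [/\ n < b, s = neseq_rcons p z, c = f n b p & m = f n b s].
Proof.
move=> nm cm /(under_topP _ nm) ns /(under_topP _ cm) cy nc.
have n_c : n <> c by move=> n_c; apply: nc; rewrite -n_c; exact: le_top.
have {}nc : ~ under_top c n (LSeq s) by rewrite -under_topP.
inversion ns as [k s0 t nk st mE| |]; subst.
inversion cy as [|a y' z ac yz e|a b p y' z ab cE yz e]; subst.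
- have [? ? t1] := f_inj nk ac e; subst.
  by left; split=> //; exists z; rewrite (neseq_le1 st).
- have [? ? t1] := f_inj nk ab e; subst.
  have [->|sp] := neseq_le_rcons st; first by right; exists b, p, z.
  by case: nc; apply: UnderTopSeq ab sp _.
Qed.

(* Here [m = f n b t] with [s <= t].  If [s] were below the parent [p] of [t],
   then [c = f n b p] and [(n, s)] would be below [top c]; so [s = t], and [c]
   determines [b]. *)
Lemma under_top_pair_unique n c m m' s y y' :
    n <> m -> c <> m -> n <> m' -> c <> m' ->
    ~ ((n, LSeq s) : P) <= top c ->
    ((n, LSeq s) : P) <= top m -> ((c, LNat y) : P) <= top m ->
    ((n, LSeq s) : P) <= top m' -> ((c, LNat y') : P) <= top m' ->
  m = m'.
Proof.
move=> nm cm nm' cm' nc nsm cym nsm' cym'.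
have := under_top_pair nm cm nsm cym nc.
have := under_top_pair nm' cm' nsm' cym' nc.
case=> [[n_c [z' sz' ->]]|[b' [p' [z' [nb' sp' cE' ->]]]]].
  case=> [[_ [z _ ->]]|[b [p [z [nb sp cE ->]]]]] //.
  by case: (@neseq1_rcons_neq z' p z); rewrite -sz' -sp.
case=> [[n_c [z sz ->]]|[b [p [z [nb sp cE ->]]]]].
  by case: (@neseq1_rcons_neq z p' z'); rewrite -sz -sp'.
have pp : p = p' by move: sp; rewrite sp' => /neseq_rcons_inj[].
by subst p'; have [_ -> _] := f_inj nb nb' (etrans (esym cE) cE').
Qed.

(** If [m = f a b t], the numbers of other levels below [top m] sit at level [b] when [t] has length
    one, and at level [f a b p] when [t] has parent [p]. *)
Lemma under_top_nat_level n c m x y : n <> m -> c <> m ->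
  (n, LNat x) <= top m :> P -> (c, LNat y) <= top m :> P -> n = c.
Proof.
move=> nm cm /(under_topP _ nm) nx /(under_topP _ cm) cy.
inversion nx as [|a x' z an _ e|a b p x' z ab nE _ e]; subst.
- inversion cy as [|a' y' z' an' _ e|a' b' p' y' z' ab' cE _ e]; subst.
  + by have [] := f_inj an an' e.
  + by have [_ _ /neseq1_rcons_neq] := f_inj an ab' e.
- inversion cy as [|a' y' z' an' _ e|a' b' p' y' z' ab' cE _ e]; subst.
  + by have [_ _ /esym/neseq1_rcons_neq] := f_inj ab an' e.
  + by have [-> -> /neseq_rcons_inj[->]] := f_inj ab ab' e.
Qed.

Lemma under_top_seq_level n c m s t : n <> m -> c <> m ->
  (n, LSeq s) <= top m :> P -> (c, LSeq t) <= top m :> P -> n = c.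
Proof.
move=> nm cm /(under_topP _ nm) ns /(under_topP _ cm) ct.
inversion ns as [k s' u nk _ e| |]; inversion ct as [k' t' u' ck' _ e'| |].
by subst; have [] := f_inj nk ck' e'.
Qed.

(** If [W] were unbounded, a few of its points would either have no common bound or determine it
    uniquely; a determined bound then has to bound all of [W]. *)
Lemma top_bounded_compact (W : set P) :
    (forall A, finite_set A -> A `<=` W ->
       exists m, forall u, A u -> u <= top m) ->
  exists m, forall u, W u -> u <= top m.
Proof.
move=> Wfin; apply: contrapT => Wunb.
have {Wunb} Wunb m : exists2 u, W u & ~ u <= top m.
  apply: contrapT => Wm; apply: Wunb; exists m => u Wu.
  by apply: contrapT => um; apply: Wm; exists u.
have W4 a b c d : W a -> W b -> W c -> W d ->
    exists m, [/\ a <= top m, b <= top m, c <= top m & d <= top m].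
  move=> Wa Wb Wc Wd.
  have [u [[[->|->]|->]|->] //|m bm] := Wfin _ (finite_set4 a b c d).
  by exists m; split; apply: bm; rewrite /=; tauto.
have W_top m : ~ W (top m).
  move=> Wm; have [w Ww wm] := Wunb m.
  have [q [mq _ wq _]] := W4 _ _ _ _ Wm Wm Ww Ww.
  by move: (top_le mq) wq => -[->] /wm.
have [[[c y'] Wcy [y /= yE]]|noNat] :=
    pselect (exists2 u, W u & exists y, u.2 = LNat y).
- subst y'.
  (* The point [(n, x)] is not below [top c], and [w] is not below [top n]; so a common bound of
     these points has a level other than [c] and [n]. *)
  have [[n x] Wnx nxc] := Wunb c; have [w Ww wn] := Wunb n.
  have bound v : W v -> exists m, [/\ (n, x) <= top m :> P,
      (c, LNat y) <= top m :> P, n <> m, c <> m & v <= top m].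
    move=> Wv; have [m [nxm cym wm vm]] := W4 _ _ _ _ Wnx Wcy Ww Wv.
    by exists m; split=> // [e|e]; [apply: wn|apply: nxc]; rewrite e.
  case: x Wnx nxc bound => [x|s|] Wnx nxc bound; last exact: W_top Wnx.
    have [m [nxm cym nm cm _]] := bound _ Wnx.
    by apply: nxc; rewrite (under_top_nat_level nm cm nxm cym); exact: le_top.
  have [m [nsm cym nm cm _]] := bound _ Wnx.
  (* A bound [m'] that also covers the escaping point [v] must again be [m]. *)
  have [v Wv vm] := Wunb m; have [m' [nsm' cym' nm' cm' vm']] := bound _ Wv.
  apply: vm.
  by rewrite (under_top_pair_unique nm cm nm' cm' nxc nsm cym nsm' cym').
- have WSeq u : W u -> exists s, u.2 = LSeq s.
    case: u => n [x|s|] Wu; [|by exists s|by case: (W_top n)].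
    by case: noNat; exists (n, LNat x) => //; exists x.
  (* The level 1 is arbitrary: it serves to produce a point of [W]. Two sequence points below a top
     of a third level share their level, which contradicts the choice of [(c, y)]. *)
  have [w0 _ _] := Wunb (Sub 1%N isT).
  have {w0} [[n x] Wnx _] := Wunb (Sub 1%N isT).
  have [[c y] Wcy cn] := Wunb n; have [w Ww wc] := Wunb c.
  have [m [nm cm wm _]] := W4 _ _ _ _ Wnx Wcy Ww Ww.
  have [s /= sE] := WSeq _ Wnx; have [t /= tE] := WSeq _ Wcy; subst.
  have n_m : n <> m by move=> e; apply: cn; rewrite e.
  have c_m : c <> m by move=> e; apply: wc; rewrite e.
  apply: cn; rewrite (under_top_seq_level n_m c_m nm cm); exact: le_top.
Qed.

(** * Unbounded chains of one level, and finiteness of lower sets *)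

Lemma under_top_nat_bounded n m : n <> m ->
  exists z, forall x, (n, LNat x) <= top m :> P -> x <= z.
Proof.
move=> nm; have [[x /(under_topP _ nm) nx]|nN] :=
    pselect (exists x, (n, LNat x) <= top m :> P); last first.
  by exists (Sub 1%N isT) => x nx; case: nN; exists x.
(* In both cases [z] is the last entry of the sequence coding [m]. *)
inversion nx as [|a y z an _ e|a b p y z ab nE _ e]; subst; exists z => x'.
- move=> /(under_topP _ nm) nx'.
  inversion nx' as [|a' y' z' an' yz e|a' b' p' y' z' ab' _ yz e]; subst.
  + have [_ _ /(congr1 val)[zz]] := f_inj an an' e; subst z'; exact: yz.
  + by have [_ _ /neseq1_rcons_neq] := f_inj an ab' e.
- move=> /(under_topP _ nm) nx'.
  inversion nx' as [|a' y' z' an' yz e|a' b' p' y' z' ab' _ yz e]; subst.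
  + by have [_ _ /esym/neseq1_rcons_neq] := f_inj ab an' e.
  + by have [_ _ /neseq_rcons_inj[_ ->]] := f_inj ab ab' e.
Qed.

Lemma under_top_seq_bounded n m : n <> m ->
  exists t, forall s, (n, LSeq s) <= top m :> P -> s <= t.
Proof.
move=> nm; have [[s /(under_topP _ nm) ns]|nN] :=
    pselect (exists s, (n, LSeq s) <= top m :> P); last first.
  by exists (neseq1 (Sub 1%N isT)) => s ns; case: nN; exists s.
inversion ns as [k s' t nk _ e| |]; subst; exists t => s2.
move=> /(under_topP _ nm) ns'; inversion ns' as [k' s3 t' nk' st' e| |]; subst.
by have [_ _ ->] := f_inj nk nk' e.
Qed.

(** Both a non-top point and the top of another level bound the numbers of level [n] that lie below
    them. *)
Lemma nat_chain_ub n (v : P) :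
  (forall x, (n, LNat x) <= v :> P) -> v = top n.
Proof.
case: v => m y nv.
have S_gt (z : posnat) : ~ (Sub (val z).+1 isT : posnat) <= z.
  by move=> zz; have : (val z < val z)%N := zz; rewrite ltnn.
have [yT|yT] := pselect (y = LTop); last first.
  case: y yT nv => [y yT|s yT|//] nv.
  - by have [_ /S_gt] := le_nontop yT (nv (Sub (val y).+1 isT)).
  - by have [] := le_nontop yT (nv (Sub 1%N isT)).
subst y; have [->//|nm] := pselect (n = m).
have [z zub] := under_top_nat_bounded nm.
by have /S_gt := zub _ (nv (Sub (val z).+1 isT)).
Qed.

Lemma seq_chain_ub n (s : nat -> neseq) (v : P) :
  (forall k, size (val (s k)) = k.+1) ->
  (forall k, (n, LSeq (s k)) <= v :> P) -> v = top n.
Proof.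
case: v => m y sz nv.
have [yT|yT] := pselect (y = LTop); last first.
  case: y yT nv => [y yT|t yT|//] nv.
  - by have [] := le_nontop yT (nv 0%N).
  (* The sequence of index [size (val t)] is one entry longer than [t]. *)
  - have [_] := le_nontop yT (nv (size (val t))).
    by move=> /neseq_le_size; rewrite sz ltnn.
subst y; have [->//|nm] := pselect (n = m).
have [t tub] := under_top_seq_bounded nm.
by have /neseq_le_size := tub _ (nv (size (val t))); rewrite sz ltnn.
Qed.

Lemma finite_below_nontop n (x : L) : x <> LTop ->
  finite_set [set u : P | u <= (n, x)].
Proof.
move=> xT.
(* [g k] is the number [k], or the prefix of length [k]; the defaults of [insubd] are reached at
   [k = 0]. *)
pose g k : P := (n, match x with
  | LNat _ => LNat (insubd (Sub 1%N isT) k)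
  | LSeq s => LSeq (insubd s (take k (val s)))
  | LTop => LTop end).
pose N := match x with LNat y => (val y).+1 | LSeq s => (size (val s)).+1
  | LTop => 0%N end.
apply: (@sub_finite_set _ _ (g @` `I_N)); last exact/finite_image/finite_II.
move=> [m y] /= /(le_nontop xT)[-> {m}]; rewrite /g /N {g N}.
case: x y xT => [x|t|//] [y|s|] // _ yx.
- by exists (val y) => //; rewrite valKd.
- exists (size (val s)); first exact: neseq_le_size.
  have /eqP -> : take (size (val s)) (val t) == val s by rewrite -prefixE.
  by congr (_, LSeq _); apply: val_inj; rewrite val_insubd (valP s).
Qed.

(** The numbers share one level and lie below a single number, and likewise the sequences; so two
    lower sets of non-top points cover everything. *)
Lemma finite_under_top m : finite_set [set u : P | u <= top m /\ u.1 <> m].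
Proof.
have fin_nat : finite_set [set u : P | [/\ u <= top m, u.1 <> m &
    exists x, u.2 = LNat x]].
  have [[n [nm [x nx]]]|nN] :=
      pselect (exists n, n <> m /\ exists x, (n, LNat x) <= top m :> P).
    have [z zub] := under_top_nat_bounded nm.
    apply: (@sub_finite_set _ _ [set u : P | u <= (n, LNat z)]).
      move=> [c y] [/= cm c_m [y' ?]]; subst y.
      have e := under_top_nat_level c_m nm cm nx; subst c.
      by apply: level_le; exact: zub.
    exact: finite_below_nontop.
  apply: (@sub_finite_set _ _ set0) => // -[c y] [/= cm c_m [y' ?]]; subst y.
  by apply: nN; exists c; split=> //; exists y'.
have fin_seq : finite_set [set u : P | [/\ u <= top m, u.1 <> m &
    exists s, u.2 = LSeq s]].
  have [[n [nm [x nx]]]|nN] :=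
      pselect (exists n, n <> m /\ exists x, (n, LSeq x) <= top m :> P).
    have [z zub] := under_top_seq_bounded nm.
    apply: (@sub_finite_set _ _ [set u : P | u <= (n, LSeq z)]).
      move=> [c y] [/= cm c_m [y' ?]]; subst y.
      have e := under_top_seq_level c_m nm cm nx; subst c.
      by apply: level_le; exact: zub.
    exact: finite_below_nontop.
  apply: (@sub_finite_set _ _ set0) => // -[c y] [/= cm c_m [y' ?]]; subst y.
  by apply: nN; exists c; split=> //; exists y'.
have := conj fin_nat fin_seq; rewrite -finite_setU; apply: sub_finite_set.
move=> [n [x|s|]] /= [nm n_m]; [by left; split=> //; exists x|
  by right; split=> //; exists s|].
by move: (top_le nm) => -[/esym/n_m].
Qed.

Lemma finite_below_two_tops m n : m <> n ->
  finite_set [set u : P | u <= top m /\ u <= top n].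
Proof.
move=> mn; apply: (@sub_finite_set _ _
  ([set u : P | u <= top m /\ u.1 <> m] `|`
   [set u : P | u <= top n /\ u.1 <> n])).
  move=> u [um un]; have [e|] := pselect (u.1 = m); last by left.
  by right; split=> //; rewrite e.
by rewrite finite_setU; split; exact: finite_under_top.
Qed.

(* All that is used of Scott opens of [P]. *)
Definition top_open (U : set P) : Prop :=
  (forall u v, u <= v -> U u -> U v) /\
  forall n (c : nat -> P), {homo c : k l / (k <= l)%N >-> k <= l} ->
    (forall k, c k <= top n) -> (forall v, (forall k, c k <= v) -> v = top n) ->
    U (top n) -> exists k, U (c k).

Lemma top_open_meet (U V : set P) : top_open U -> top_open V ->
  forall n m, n < m -> U (top n) -> V (top m) ->
  exists q, U (top q) /\ V (top q).
Proof.
move=> [Uup Uc] [Vup Vc] n m nm Un Vm.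
(* The numbers of level [q] have supremum [top q], so [V] contains one of them as soon as it
   contains [top q]. *)
have step q : exists x, V (top q) -> V (q, LNat x).
  have [Vq|NVq] := pselect (V (top q)); last by exists (Sub 1%N isT).
  have [|||k] := Vc q (fun k => (q, LNat (Sub k.+1 isT))) _ _ _ Vq.
  - by move=> k l kl; apply: level_le.
  - by move=> k; exact: le_top.
  - move=> v qv; apply: nat_chain_ub => -[[//|x] x0].
    have -> : exist _ x.+1 x0 = Sub x.+1 isT :> posnat by exact: val_inj.
    exact: qv.
  - by exists (Sub k.+1 isT).
have {step} [g gV] := choice step.
pose s := fix s k := if k is k'.+1 then neseq_rcons (s k') (g (f n m (s k')))
                     else neseq1 (g m).
(* [P_lt3] puts [(m, g m)] below the first of these tops. With [q = f n m (s k)], [P_lt4] puts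
   [(q, g q)] below the next one, since [g q] is the entry appended to [s k]. *)
have sV k : V (top (f n m (s k))).
  elim: k => [|k IH].
    by apply: Vup (gV _ Vm); apply: under_top_le; exact: UnderTopNat1 nm _ _.
  by apply: Vup (gV _ IH); apply: under_top_le; exact: UnderTopNat nm _ _ _.
have [|||k Uk] := Uc n (fun k => (n, LSeq (s k))) _ _ _ Un.
- apply: homo_leq => [u|v u w|k] //; first exact: le_trans.
  by apply: level_le; exact: le_neseq_rcons.
- by move=> k; exact: le_top.
- move=> v; apply: seq_chain_ub => k.
  by elim: k => //= k IH; rewrite size_rcons IH.
(* [P_lt2] puts [(n, s k)] below this top. *)
exists (f n m (s k)); split; last exact: sV.
by apply: Uup Uk; apply: under_top_le; exact: UnderTopSeq nm _ _.
Qed.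

End Order_on_P.

(** * Finitely generated lower sets of a well-founded poset with binary meets *)

Section Finitely_generated_lower_sets.
Context {d : Order.disp_t} (R : porderType d).
Implicit Types (A B G : set R) (r : R).

(* Stated as membership in the set defining the carrier of [F]. *)
Definition fin_gen A := [set down G | G in [set G : set R | finite_set G]] A.

Lemma fin_gen_down G : finite_set G -> fin_gen (down G).
Proof. by exists G. Qed.

Lemma down_sub G A : G `<=` A -> (forall x y, x <= y -> A y -> A x) ->
  down G `<=` A.
Proof. by move=> GA Alow x [y [/GA Ay xy]]; exact: Alow Ay. Qed.

Lemma fin_gen_lower A : fin_gen A -> forall x y, x <= y -> A y -> A x.
Proof.
move=> [G _ <-] x y xy [z [Gz yz]]; exists z; split=> //; exact: le_trans yz.
Qed.

Lemma fin_gen_bigcup G (B : R -> set R) : finite_set G ->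
  (forall g, G g -> fin_gen (B g)) -> fin_gen (\bigcup_(g in G) B g).
Proof.
move=> Gfin Bfg.
have gen g : exists H, G g -> finite_set H /\ down H = B g.
  have [Gg|NGg] := pselect (G g); last by exists set0.
  by have [H ? ?] := Bfg _ Gg; exists H.
have [H HP] := choice gen.
exists (\bigcup_(g in G) H g).
  by apply: bigcup_finite => // g /HP[].
rewrite seteqP; split.
- by move=> x [y [[g Gg Hy] xy]]; exists g => //; rewrite -(HP g Gg).2; exists y.
- move=> x [g Gg]; rewrite -(HP g Gg).2 => -[y [Hy xy]].
  by exists y; split=> //; exists g.
Qed.

Lemma fin_genU A B : fin_gen A -> fin_gen B -> fin_gen (A `|` B).
Proof.
move=> [G Gfin <-] [H Hfin <-]; exists (G `|` H); first by rewrite /= finite_setU.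
rewrite seteqP; split=> x.
- by move=> [y [[Gy|Hy] xy]]; [left|right]; exists y.
- by move=> [] [y [Gy xy]]; exists y; split=> //; [left|right].
Qed.

Hypothesis lt_wf : well_founded (fun x y : R => x < y).
Hypothesis has_meet : forall x y : R, infimums [set x; y] !=set0.

(* If [r] is outside some member [down G] of the family, then [down r] may be
   replaced by the finitely many strictly smaller [down (meet r g)], [g \in G]. *)
Lemma fin_gen_bigcap_down (AA : set (set R)) r : AA `<=` fin_gen ->
  fin_gen (down [set r] `&` \bigcap_(A in AA) A).
Proof.
move=> AAfg; elim/(well_founded_ind lt_wf): r => r IH.
have [rAA|] := pselect ((\bigcap_(A in AA) A) r).
  rewrite (_ : _ `&` _ = down [set r]); first exact/fin_gen_down/finite_set1.
  apply/setIidPl => x [y [/= -> xr]] A AAA.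
  exact: fin_gen_lower (AAfg _ AAA) _ _ xr (rAA _ AAA).
move=> rNA; have [A AAA NAr] : exists2 A, AA A & ~ A r.
  apply: contrapT => N; apply: rNA => A AAA; apply: contrapT => NAr.
  by apply: N; exists A.
have [G Gfin AG] := AAfg _ AAA.
have [mt mtP] := choice (fun g => has_meet r g).
have -> : down [set r] `&` \bigcap_(A in AA) A =
    \bigcup_(g in G) (down [set mt g] `&` \bigcap_(A in AA) A).
  rewrite seteqP; split=> x.
  - move=> [[y [/= -> xr]] xAA]; have := xAA _ AAA; rewrite -AG => -[g [Gg xg]].
    exists g => //; split=> //; exists (mt g); split=> //.
    by apply: (mtP g).2 => z [->|->].
  - move=> [g Gg [[y [/= -> xg]] xAA]]; split=> //; exists r; split=> //.
    by apply: le_trans xg _; apply: (mtP g).1; left.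
apply: fin_gen_bigcup => // g Gg; apply: IH; rewrite lt_neqAle.
apply/andP; split; last by apply: (mtP g).1; left.
apply/eqP => e; apply: NAr; rewrite -AG; exists g; split=> //.
by rewrite -e; apply: (mtP g).1; right.
Qed.

(** A greatest element [t] makes [down [set t]] the whole poset, so the relative statement becomes
    absolute and covers the empty family. The top added to [M] provides this [t]. *)
Lemma fin_gen_bigcap (t : R) (AA : set (set R)) : (forall x, x <= t) ->
  AA `<=` fin_gen -> fin_gen (\bigcap_(A in AA) A).
Proof.
move=> tT /fin_gen_bigcap_down => /(_ t).
by rewrite (_ : down [set t] = setT) ?setTI// -subTset => x _; exists t.
Qed.

(** If the chain escaped each generator [g] at some index [e g], then at an index [K] above these
    finitely many indices it would escape all generators at once. *)
Lemma fin_gen_chain A (c : nat -> R) : fin_gen A ->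
  {homo c : k l / (k <= l)%N >-> k <= l} -> (forall k, A (c k)) ->
  exists r, A r /\ forall k, c k <= r.
Proof.
move=> [G Gfin <-] c_homo cG; apply: contrapT => N.
have esc g : exists k, G g -> ~ c k <= g.
  have [Gg|] := pselect (G g); last by exists 0%N.
  apply: contrapT => H; apply: N; exists g; split; first by exists g.
  by move=> k; apply: contrapT => ckg; apply: H; exists k.
have [e eP] := choice esc.
have [K KP] : exists K, forall g, G g -> (e g <= K)%N.
  have [s sP] : exists s : seq nat, e @` G = [set` s].
    exact/finite_seqP/finite_image.
  exists (\max_(k <- s) k)%N => g Gg.
  have egs : e g \in s by have : [set` s] (e g) by rewrite -sP; exists g.
  exact: (@leq_bigmax_seq _ s xpredT id).
have [g [Gg cKg]] := cG K.
by apply: (eP g Gg); apply: le_trans cKg; apply: c_homo; exact: KP.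
Qed.

End Finitely_generated_lower_sets.

(** * Well-foundedness and meets after adding a top *)

Section Add_top.
Context {d : Order.disp_t} (T : porderType d).

Lemma le_SomeE (x y : T) : (Some x <= Some y :> add_top T) = (x <= y).
Proof. by []. Qed.

Lemma le_None (x : add_top T) : x <= None.
Proof. by case: x. Qed.

Lemma add_top_wf : well_founded (fun x y : T => x < y) ->
  well_founded (fun x y : add_top T => x < y).
Proof.
move=> wf; have AccS x : Acc (fun x y : add_top T => x < y) (Some x).
  elim/(well_founded_ind wf): x => x IH; constructor => -[y|] yx.
    apply: IH; move: yx; rewrite !lt_neqAle le_SomeE => /andP[yx ->]; rewrite andbT.
    by apply: contra yx => /eqP ->.
  by move: yx; rewrite lt_neqAle => /andP[].
case=> [x|]; first exact: AccS.
by constructor => -[y _|]; [exact: AccS|rewrite ltxx].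
Qed.

Lemma add_top_has_meet : (forall x y : T, infimums [set x; y] !=set0) ->
  forall x y : add_top T, infimums [set x; y] !=set0.
Proof.
move=> mt [x|] [y|].
- have [z [zlb zub]] := mt x y; exists (Some z); split.
    by move=> u [->|->]; apply: zlb; [left|right].
  move=> [u|] ulb; last by have := ulb (Some x) (or_introl erefl).
  apply: zub => v [->|->].
    by apply: (ulb (Some x)); left.
  by apply: (ulb (Some y)); right.
- exists (Some x); split; first by move=> u [->|->].
  by move=> u; apply; left.
- exists (Some y); split; first by move=> u [->|->].
  by move=> u; apply; right.
- by exists None; split=> [u [->|->]|u _]//; case: u.
Qed.

End Add_top.

Lemma injective_countable {T U : Type} (g : T -> U) :
  injective g -> countable (range g) -> countable [set: T].
Proof.
move=> g_inj /countable_injP[h h_inj]; apply/countable_injP; exists (h \o g).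
move=> x y _ _ /= hxy; apply: g_inj; apply: h_inj hxy; rewrite in_setE; exact: imageT.
Qed.

(** * The structure of [M], and the countable complete distributive lattice [F] *)

Section Lattice_of_lower_sets.
Variables (i : posnat -> posnat -> set posnat).
Variables (f : posnat -> posnat -> neseq -> posnat).
Hypothesis i_disjoint : forall m1 n1 m2 n2 : posnat, m1 < n1 -> m2 < n2 ->
     (m1, n1) <> (m2, n2) -> i m1 n1 `&` i m2 n2 = set0.
Hypothesis f_bij :
  forall m n : posnat, m < n -> set_bij [set: neseq] (i m n) (f m n).

Local Notation P := (P i f).
Local Notation M := (M i f).
Local Notation R := (R i f).
Local Notation F := (F i f).
Local Notation top := (fun m : posnat => (m, LTop) : P).

Lemma M_le (r s : M) : (r <= s) = (val r `<=` val s) :> Prop.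
Proof. by rewrite -subsetEset. Qed.

Lemma M_valP (r : M) : exists2 E : set P, E !=set0 &
  val r = [set x | forall y, E y -> x <= y].
Proof. by have [E E0 <-] := set_valP r; exists E. Qed.

Lemma M_subproof (E : set P) : E !=set0 ->
  \bigcap_(x in E) [set y | y <= x] \in [set \bigcap_(x in E) [set y | y <= x]
     | E in [set E : set P | E !=set0]].
Proof. by move=> E0; rewrite in_setE; exists E. Qed.

Definition M_of (E : set P) (E0 : E !=set0) : M :=
  @exist _ (fun A => A \in _) _ (M_subproof E0).

Definition princ (p : P) : M := 
  M_of (ex_intro (fun q => [set p] q) p erefl).

Lemma val_princ p : val (princ p) = [set y | y <= p].
Proof. by rewrite /= bigcap_set1. Qed.

Lemma princ_le p (r : M) : (princ p <= r) = val r p :> Prop.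
Proof.
rewrite M_le val_princ propeqE; split=> [/(_ p)|]; first by apply; exact: lexx.
by have [E _ ->] := M_valP r => pE x /= xp y /pE; exact: le_trans.
Qed.

(** A non-top point in [E], or two different tops, confines the intersection to a finite set;
    otherwise [E] consists of one top. *)
Lemma M_finite_or_top (r : M) :
  finite_set (val r) \/ exists m, r = princ (top m).
Proof.
have [E [p Ep] rE] := M_valP r.
have [[[n x] Enx xT]|allT] := pselect (exists2 q, E q & q.2 <> LTop).
  left; have := finite_below_nontop i f n xT; apply: sub_finite_set.
  by rewrite rE => u /(_ _ Enx).
have {}allT q : E q -> q = top q.1.
  move=> Eq; have [|N] := pselect (q.2 = LTop); first by case: q {Eq} => n x /= ->.
  by case: allT; exists q.
have [[q Eq qp]|allp] := pselect (exists2 q, E q & q.1 <> p.1).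
  left; have := finite_below_two_tops i_disjoint f_bij qp.
  apply: sub_finite_set.
  by rewrite rE => u uE; split; [have := uE _ Eq; rewrite {1}(allT q Eq)|
    have := uE _ Ep; rewrite {1}(allT p Ep)].
right; exists p.1; apply: val_inj; rewrite val_princ rE seteqP; split=> u /=.
  by move=> /(_ p Ep); rewrite {1}(allT p Ep).
move=> up q Eq; rewrite (allT q Eq) (_ : q.1 = p.1) //.
by apply: contrapT => qp; apply: allp; exists q.
Qed.

Lemma M_finite_wf (r : M) :
  finite_set (val r) -> Acc (fun x y : M => x < y) r.
Proof.
have [n] := ubnP #|` fset_set (val r)|.
elim: n r => [|n IH] r rn rfin; first by rewrite ltn0 in rn.
constructor => s sr.
have srsub : val s `<=` val r by rewrite -M_le; exact: ltW.
have sfin := sub_finite_set srsub rfin.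
apply: (IH s _ sfin); rewrite ltnS in rn; apply: leq_trans rn.
apply: fproper_ltn_card; rewrite fproperEneq; apply/andP; split.
  apply/eqP => /(fset_set_inj sfin rfin)/val_inj e.
  by move: sr; rewrite e ltxx.
rewrite -fset_set_sub; [exact: srsub|exact: sfin|exact: rfin].
Qed.

(** Different tops are incomparable, so everything strictly below [princ (top m)] is finite and
    hence accessible. *)
Lemma M_wf : well_founded (fun x y : M => x < y).
Proof.
move=> r; have [/M_finite_wf//|[m rE]] := M_finite_or_top r.
constructor => s; rewrite rE => sm.
have [/M_finite_wf//|[n sE]] := M_finite_or_top s; exfalso; move: sm.
rewrite sE lt_neqAle => /andP[/eqP nm]; rewrite princ_le val_princ /= => /top_le nE.
by apply: nm; rewrite nE.
Qed.

Lemma M_has_meet (r s : M) : infimums [set r; s] !=set0.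
Proof.
have [E E0 rE] := M_valP r; have [E' E'0 sE] := M_valP s.
(* The meet is the intersection indexed by the union of both index sets. *)
have EE'0 : E `|` E' !=set0 by case: E0 => p Ep; exists p; left.
exists (M_of EE'0); split.
- by move=> u [->|->]; rewrite M_le ?rE ?sE => p pE q Eq; apply: pE; [left|right].
- move=> u ulb; rewrite M_le => p up q [Eq|E'q].
  + by have := ulb r (or_introl erefl); rewrite M_le rE => /(_ p up); exact.
  + by have := ulb s (or_intror erefl); rewrite M_le sE => /(_ p up); exact.
Qed.

Lemma P_countable : countable [set: P].
Proof.
pose g (p : P) : nat * (nat + neseq + unit) := (val p.1, match p.2 with
  | LNat x => inl (inl (val x)) | LSeq s => inl (inr s) | LTop => inr tt end).
apply: (@injective_countable _ _ g) => // -[n x] [m y] [nm xy].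
congr (_, _); first exact: val_inj.
move: x y xy => [x|s|] [y|t|] //.
  by case=> xy; congr LNat; exact: val_inj.
by case=> ->.
Qed.

Lemma M_countable : countable [set: M].
Proof.
apply: (@injective_countable _ _ val val_inj).
pose A b : set (set P) := if b then [set A | A `<=` setT /\ finite_set A]
  else range (fun m => [set y | y <= top m]).
apply: (@sub_countable _ _ _ (\bigcup_b A b)).
  apply: subset_card_le => _ [r _ <-].
  have [rfin|[m ->]] := M_finite_or_top r; first by exists true.
  by exists false => //; exists m => //; rewrite val_princ.
apply: bigcup_countable => [|[] _]; first exact: countableP.
  exact/countable_finite_subset/P_countable.
apply: sub_countable (card_image_le _ _) _.
exact: (@injective_countable _ _ val val_inj).
Qed.

Lemma R_countable : countable [set: R].
Proof.
have /countable_injP[h h_inj] := M_countable.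
apply/countable_injP; exists (fun r => if r is Some x then (h x).+1 else 0%N).
by move=> [x|] [y|] _ _ //= [/h_inj ->]//; rewrite in_setE.
Qed.

Lemma F_le (B C : F) : (B <= C) = (val B `<=` val C) :> Prop.
Proof. by rewrite -subsetEset. Qed.

Lemma F_fin_gen (B : F) : fin_gen (val B).
Proof. exact: set_valP. Qed.

Definition F_of (A : set R) (Afg : fin_gen A) : F :=
  @exist _ (fun A => A \in _) A (@mem_set (set R) (@fin_gen _ R) A Afg).

Lemma F_countable : countable [set: F].
Proof.
apply: (injective_countable val_inj).
apply: sub_countable (countable_finite_subset R_countable).
apply: card_le_trans (card_image_le (@down _ _) _).
apply: subset_card_le => _ [B _ <-]; have [G Gfin <-] := F_fin_gen B.
by exists G.
Qed.

Lemma R_fin_gen_bigcap (AA : set (set R)) :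
  AA `<=` @fin_gen _ R -> fin_gen (\bigcap_(A in AA) A).
Proof.
apply: (fin_gen_bigcap _ _ (@le_None _ M)).
- exact: add_top_wf M_wf.
- exact: add_top_has_meet M_has_meet.
Qed.

Lemma F_has_inf (AA : set F) : infimums AA !=set0.
Proof.
have fg : [set val B | B in AA] `<=` @fin_gen _ R.
  by move=> _ [B _ <-]; exact: F_fin_gen.
exists (F_of (R_fin_gen_bigcap fg)); split.
- by move=> B AAB; rewrite F_le => x; apply; exists B.
- move=> C Clb; rewrite F_le => x Cx _ [B AAB <-].
  by have := Clb B AAB; rewrite F_le; apply.
Qed.

Lemma F_complete : complete_lattice F.
Proof.
move=> AA; split; last exact: F_has_inf.
(* The supremum is obtained as the infimum of the upper bounds. *)
have [B [Blb Bub]] := F_has_inf (ubound AA); exists B; split.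
- by move=> C AAC; apply: Bub => D; exact.
- by move=> C; exact: Blb.
Qed.

Lemma F_distributive : distributive_lattice F.
Proof.
have fgI (B C : F) : fin_gen (val B `&` val C).
  have := @R_fin_gen_bigcap [set val B; val C].
  by rewrite bigcap_setU !bigcap_set1; apply => _ [->|->]; exact: F_fin_gen.
pose meet B C := F_of (fgI B C).
pose join B C := F_of (fin_genU (F_fin_gen B) (F_fin_gen C)).
exists meet, join; split.
- move=> B C; split; first by move=> D [->|->]; rewrite F_le => x [].
  move=> D Dlb; rewrite F_le subsetI -!F_le; split; apply: Dlb; [by left|by right].
- move=> B C; split; first by move=> D [->|->]; rewrite F_le => x Dx; [left|right].
  move=> D Dub; rewrite F_le subUset -!F_le; split; apply: Dub; [by left|by right].
- by move=> B C D; apply: val_inj => /=; rewrite setIUl.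
Qed.

Definition F_princ (p : P) : F :=
  F_of (fin_gen_down (finite_set1 (Some (princ p) : R))).

Lemma F_princ_le p (B : F) : (F_princ p <= B) = val B (Some (princ p)) :> Prop.
Proof.
rewrite F_le propeqE; split=> [|Bp]; first by apply; exists (Some (princ p)).
by apply: down_sub => [_ ->//|]; exact: fin_gen_lower (F_fin_gen B).
Qed.

Lemma F_princ_mono p q : (F_princ p <= F_princ q) = (p <= q) :> Prop.
Proof.
rewrite F_princ_le propeqE; split.
  by move=> [_ [->]]; rewrite le_SomeE princ_le val_princ.
by move=> pq; exists (Some (princ q)); split=> //; rewrite le_SomeE princ_le val_princ.
Qed.

(** An upper bound [B] contains the chain, so by [fin_gen_chain] a single [r] in [B] lies above it.
    Unless [r] is the added top, it is cut out by a set [E] whose members all bound the chain and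
    thus equal [top n]; so [princ (top n) <= r]. *)
Lemma F_princ_sup n (c : nat -> P) : {homo c : k l / (k <= l)%N >-> k <= l} ->
    (forall k, c k <= top n) -> (forall v, (forall k, c k <= v) -> v = top n) ->
  supremums (range (F_princ \o c)) (F_princ (top n)).
Proof.
move=> c_homo c_top c_ub; split; first by move=> _ [k _ <-]; rewrite F_princ_mono.
move=> B Bub; rewrite F_princ_le.
have [||r [Br cr]] :=
  @fin_gen_chain _ R _ (fun k => Some (princ (c k))) (F_fin_gen B).
- by move=> k l kl; rewrite le_SomeE princ_le val_princ; exact: c_homo.
- by move=> k; rewrite -F_princ_le; apply: Bub; exists k.
apply: fin_gen_lower (F_fin_gen B) _ _ _ Br.
case: r cr => [r|]//; rewrite le_SomeE => cr.
rewrite princ_le; have [E _ rE] := M_valP r; rewrite rE /= => y Ey.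
rewrite (c_ub y) // => k; have := cr k; rewrite le_SomeE princ_le rE; exact.
Qed.

End Lattice_of_lower_sets.

(** * Principal lower sets are Scott closed *)

Section Scott_topology.
Context {d : Order.disp_t} {T : porderType d}.

Lemma open_scottE (U : set (scott T)) : open U = scott_open (U : set T).
Proof. by []. Qed.

Lemma scott_closed_down (x : T) : closed ([set y | y <= x] : set (scott T)).
Proof.
rewrite -[X in closed X]setCK; apply: open_closedC; rewrite open_scottE; split.
  by move=> y z yz /= yx zx; apply: yx; exact: le_trans zx.
move=> D s _ [_ Ds] sx; apply: contrapT => N; apply: sx; apply: Ds => y Dy.
by apply: contrapT => yx; apply: N; exists y.
Qed.

Lemma scott_closure_sub (x : T) :
  closure ([set x] : set (scott T)) `<=` [set y | y <= x].
Proof. rewrite [X in _ `<=` X](iffLR (closure_id _) (@scott_closed_down x)).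
by apply: closureS => _ ->; exact: lexx. Qed.

End Scott_topology.

(** * A closed irreducible set of [F] that is not the closure of a point *)

Section Not_sober.
Variables (i : posnat -> posnat -> set posnat).
Variables (f : posnat -> posnat -> neseq -> posnat).
Hypothesis i_disjoint : forall m1 n1 m2 n2 : posnat, m1 < n1 -> m2 < n2 ->
     (m1, n1) <> (m2, n2) -> i m1 n1 `&` i m2 n2 = set0.
Hypothesis f_bij :
  forall m n : posnat, m < n -> set_bij [set: neseq] (i m n) (f m n).

Local Notation P := (P i f).
Local Notation F := (F i f).
Local Notation top := (fun m : posnat => (m, LTop) : P).

Definition top_bounded : set (scott F) :=
  [set B : F | exists m, B <= F_princ (top m)].

Lemma le_F_princ_top (B : F) m : B <= F_princ (top m) <->
  forall r, val B r -> exists s, r = Some s /\ val s `<=` [set p | p <= top m].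
Proof.
rewrite F_le; split.
- move=> Bm r /Bm[_ [-> rm]]; case: r rm => [s|]// sm; exists s; split=> //.
  by move: sm; rewrite le_SomeE M_le val_princ.
- move=> Bm r /Bm[s [-> sm]]; exists (Some (princ (top m))); split=> //.
  by rewrite le_SomeE M_le val_princ.
Qed.

Lemma top_bounded_closed : closed top_bounded.
Proof.
rewrite -[X in closed X]setCK; apply: open_closedC; rewrite open_scottE; split.
  by move=> B C BC /= NB [m Cm]; apply: NB; exists m; exact: le_trans Cm.
move=> D s [[B0 DB0] Ddir] [_ Ds] Ns; apply: contrapT => DN; apply: Ns.
have {DN} Dm B : D B -> exists m, B <= F_princ (top m).
  by move=> DB; apply: contrapT => NB; apply: DN; exists B.
(* [W] gathers the points of [P] occurring in members of [D]. A level bounding [W] bounds all of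
   [D], hence its supremum. *)
pose W : set P := [set p | exists2 B, D B & exists2 r, val B (Some r) & val r p].
have [|m Wm] := @top_bounded_compact _ _ i_disjoint f_bij W; last first.
  exists m; apply: Ds => B DB; apply/le_F_princ_top => r Br.
  have [n /le_F_princ_top Bn] := Dm B DB; have [r' [rE _]] := Bn r Br.
  exists r'; split=> // p r'p; apply: Wm; exists B => //; exists r' => //.
  by rewrite -rE.
move=> A Afin AW.
(* Directedness collects a finite part of [W] inside one member of [D], by induction on a list
   enumerating that part. *)
have [B DB BA] : exists2 B, D B &
    forall p, A p -> exists2 r, val B (Some r) & val r p.
  have [l AE] := iffLR (finite_seqP A) Afin; subst A.
  elim: l AW {Afin} => [|p l IH] AW; first by exists B0.
  have [|B DB Bs] := IH.
    by move=> q qs; apply: AW; rewrite /= in_cons qs orbT.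
  have [|C DC [r Cr rp]] := AW p; first by rewrite /= mem_head.
  have [E DE [BE CE]] := Ddir _ _ DB DC; exists E => // q /=.
  rewrite in_cons => /predU1P[->|/Bs[r' Br' r'q]].
    by exists r => //; move: CE; rewrite F_le; exact.
  by exists r' => //; move: BE; rewrite F_le; exact.
have [m /le_F_princ_top Bm] := Dm B DB; exists m => p /BA[r Br rp].
by have [_ [[<-] rm]] := Bm _ Br; exact: rm.
Qed.

(** The chains in the definition of [top_open] are those whose supremum is preserved by [F_princ],
    according to [F_princ_sup]. *)
Lemma scott_open_top_open (U : set F) :
  scott_open U -> top_open [set p : P | U (F_princ p)].
Proof.
move=> [Uup Udir]; split.
  by move=> u v uv; apply: Uup; rewrite F_princ_mono.
move=> n c c_homo c_top c_ub Un.
have [|_ [[k _ <-] Uck]] := Udir _ _ _ (F_princ_sup c_homo c_top c_ub) Un;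
  last by exists k.
split; first by exists (F_princ (c 0%N)); exists 0%N.
move=> _ _ [k _ <-] [l _ <-]; exists (F_princ (c (maxn k l))).
  by exists (maxn k l).
by rewrite !F_princ_mono; split; apply: c_homo; rewrite ?leq_maxl ?leq_maxr.
Qed.

Lemma top_bounded_irreducible : irreducible_set top_bounded.
Proof.
split; first by exists (F_princ (top (Sub 1%N isT))); exists (Sub 1%N isT).
move=> B C Bcl Ccl ABC; apply: contrapT => /not_orP[NB NC].
(* The complement of [X] is an upper set, so a bounded element outside [X] pushes the top above it
   outside too. *)
have topN (X : set (scott F)) : closed X -> ~ top_bounded `<=` X ->
    top_open [set p : P | (~` X) (F_princ p)] /\ exists n, ~ X (F_princ (top n)).
  move=> Xcl NX.
  have Xop : scott_open (~` X : set F) by rewrite -open_scottE; exact: closed_openC.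
  split; first exact: scott_open_top_open.
  have [D [n Dn] NXD] : exists2 D, top_bounded D & ~ X D.
    apply: contrapT => N; apply: NX => D AD; apply: contrapT => NXD.
    by apply: N; exists D.
  by exists n; exact: Xop.1 Dn NXD.
have [Bop [n Bn]] := topN B Bcl NB; have [Cop [m Cm]] := topN C Ccl NC.
have [q [Bq Cq]] : exists q, ~ B (F_princ (top q)) /\ ~ C (F_princ (top q)).
  (* [top_open_meet] needs its levels in strict order; for equal levels [top n] itself avoids both
     closed sets. *)
  have [nm|mn|e] := ltgtP n m.
  - exact: (top_open_meet i_disjoint f_bij Bop Cop nm Bn Cm).
  - have [q [? ?]] := top_open_meet i_disjoint f_bij Cop Bop mn Cm Bn.
    by exists q.
  - by exists n; rewrite {2}e.
by have [] := ABC (F_princ (top q)); first by exists q.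
Qed.

(** A generic point would lie below one [top n] and above every [top m], so the tops of levels 1 and
    2 would both equal [top n]. *)
Lemma F_not_sober : ~ sober_space (scott F).
Proof.
move=> [_ /(_ _ top_bounded_closed top_bounded_irreducible) [x Ax]].
have xcl : top_bounded x by rewrite Ax; exact: subset_closure.
have [n xn] := xcl.
have topn m : top m <= top n.
  rewrite -F_princ_mono; apply: le_trans xn; apply: scott_closure_sub.
  by rewrite -Ax; exists m.
have e1 := top_le (topn (Sub 1%N isT)); have e2 := top_le (topn (Sub 2%N isT)).
by rewrite e1 in e2.
Qed.

End Not_sober.

Unset Implicit Arguments.

Theorem theorem4p7
  (i : posnat -> posnat -> set posnat)
  (f : posnat -> posnat -> neseq -> posnat)
  (i_infinite : forall m n : posnat, m < n -> infinite_set (i m n))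
  (i_gt : forall m n : posnat, m < n -> forall k, i m n k -> n < k)
  (i_disjoint : forall m1 n1 m2 n2 : posnat, m1 < n1 -> m2 < n2 ->
     (m1, n1) <> (m2, n2) -> i m1 n1 `&` i m2 n2 = set0)
  (f_bij : forall m n : posnat, m < n -> set_bij [set: neseq] (i m n) (f m n))
  (f_mono : forall m n : posnat, m < n -> {homo f m n : s t / s <= t}) :
  [/\ countable [set: F i f],
      complete_lattice (F i f),
      distributive_lattice (F i f) &
      ~ sober_space (scott (F i f))].
Proof.
split.
- exact: (F_countable i_disjoint f_bij).
- exact: (F_complete i_disjoint f_bij).
- exact: (F_distributive i_disjoint f_bij).
- exact: (F_not_sober i_disjoint f_bij).
Qed.
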